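(* There exist absolute constants $C>0$ and $c>0$ such that the following holds. For every positive integer $n$, there exists a nonzero trilinear form $\Phi:\ell_\infty^n\times\ell_\infty^n\times\ell_\infty^n\to\mathbb{C}$ such that $$\|\Phi\|_{\mathrm{sym}}\ \geq\ C\,n^{c}\,\|\Phi\|_{\mathrm{jcb}}.$$
   Context: $\ell_\infty^n$ is the commutative $C^*$-algebra $\mathbb{C}^n$ with the sup norm and coordinate-wise multiplication; $e_1,\dots,e_n$ is the standard basis of $\mathbb{C}^n$ and $[n]=\{1,\dots,n\}$. $M_d$ is the space of complex $d\times d$ matrices with the operator norm, and $B_{M_d}=\{X\in M_d : \|X\|\le 1\}$. For a trilinear form $\Phi:\ell_\infty^n\times\ell_\infty^n\times\ell_\infty^n\to\mathbb{C}$: Completely bounded norm: $$\|\Phi\|_{\mathrm{cb}}=\sup\Big\{\Big\|\sum_{i,j,k=1}^n\Phi(e_i,e_j,e_k)\,X(i)Y(j)Z(k)\Big\|_{M_d} : d\in\mathbb{N},\ X,Y,Z:[n]\to B_{M_d}\Big\}.$$ Jointly completely bounded norm: $$\|\Phi\|_{\mathrm{jcb}}=\sup\Big\{\Big\|\sum_{i,j,k=1}^n\Phi(e_i,e_j,e_k)\,X(i)\otimes Y(j)\otimes Z(k)\Big\|_{M_{d^3}} : d\in\mathbb{N},\ X,Y,Z:[n]\to B_{M_d}\Big\}.$$ For $\pi\in S_3$ (the permutation group of $\{1,2,3\}$), the trilinear form $\Phi\circ\pi$ is defined by $(\Phi\circ\pi)(a_{\pi(1)},a_{\pi(2)},a_{\pi(3)})=\Phi(a_1,a_2,a_3)$.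 Symmetrized completely bounded norm: $$\|\Phi\|_{\mathrm{sym}}=\inf\Big\{\sum_{\pi\in S_3}\|\Psi_\pi\circ\pi\|_{\mathrm{cb}} : \Phi=\sum_{\pi\in S_3}\Psi_\pi\Big\},$$ where the infimum is over trilinear forms $\Psi_\pi:\ell_\infty^n\times\ell_\infty^n\times\ell_\infty^n\to\mathbb{C}$ indexed by $\pi\in S_3$. *)

(* Defs.v *)
(* Mathematical Components with MathComp-Analysis; the complex numbers are
   R[i] for R : realType. *)
From HB Require Import structures.
From mathcomp Require Import all_boot all_order all_algebra all_fingroup.
From mathcomp Require Import all_classical all_reals all_analysis.
From mathcomp Require Import complex mxtens.

Set Implicit Arguments.
Unset Strict Implicit.
Unset Printing Implicit Defensive.

Import Order.TTheory GRing.Theory Num.Theory.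

Local Open Scope classical_set_scope.
Local Open Scope ring_scope.
Local Open Scope complex_scope.

Definition l2norm (R : realType) (d : nat) (v : 'cV[R[i]]_d) : R :=
  Num.sqrt (\sum_(i < d) ComplexField.Normc.normc (v i 0) ^+ 2).

(* All suprema and infima are taken in \bar R, so that no boundedness
   side condition is hidden in them. *)
Definition opnorm (R : realType) (d : nat) (A : 'M[R[i]]_d) : \bar R :=
  ereal_sup [set (l2norm (A *m v))%:E | v in [set v | l2norm v <= 1]].

Definition mxball (R : realType) (d : nat) : set 'M[R[i]]_d :=
  [set X | (opnorm X <= 1)%E].

Definition form3 (R : realType) (n : nat) : Type :=
  'rV[R[i]]_n -> 'rV[R[i]]_n -> 'rV[R[i]]_n -> R[i].

Definition trilinear (R : realType) (n : nat) (Phi : form3 R n) : Prop :=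
  [/\ forall y z, scalar (fun x => Phi x y z),
      forall x z, scalar (fun y => Phi x y z) &
      forall x y, scalar (fun z => Phi x y z)].

Definition stdb (R : realType) (n : nat) (i : 'I_n) : 'rV[R[i]]_n :=
  delta_mx 0 i.

Definition cb_norm (R : realType) (n : nat) (Phi : form3 R n) : \bar R :=
  ereal_sup [set t | exists (d : nat) (X Y Z : 'I_n -> 'M[R[i]]_d),
    [/\ (0 < d)%N,
        forall i, mxball (X i), forall i, mxball (Y i),
        forall i, mxball (Z i) &
        t = opnorm (\sum_(i < n) \sum_(j < n) \sum_(k < n)
              Phi (stdb R i) (stdb R j) (stdb R k) *:
                (X i *m Y j *m Z k))]].

Definition jcb_norm (R : realType) (n : nat) (Phi : form3 R n) : \bar R :=
  ereal_sup [set t | exists (d : nat) (X Y Z : 'I_n -> 'M[R[i]]_d),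
    [/\ (0 < d)%N,
        forall i, mxball (X i), forall i, mxball (Y i),
        forall i, mxball (Z i) &
        t = opnorm (\sum_(i < n) \sum_(j < n) \sum_(k < n)
              Phi (stdb R i) (stdb R j) (stdb R k) *:
                (X i *t Y j *t Z k))]].

(* Phi \o pi, characterized by form3_permE below; {1,2,3} is 'I_3. *)
Definition form3_perm (R : realType) (n : nat) (Phi : form3 R n) (p : 'S_3) :
    form3 R n :=
  fun x y z => let b i := tnth [tuple x; y; z] ((p^-1)%g i) in
    Phi (b 0) (b 1) (b 2).

Lemma form3_permE (R : realType) (n : nat) (Phi : form3 R n) (p : 'S_3)
    (a : 'I_3 -> 'rV[R[i]]_n) :
  form3_perm Phi p (a (p 0)) (a (p 1)) (a (p 2)) = Phi (a 0) (a 1) (a 2).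
Proof.
have bE i : tnth [tuple a (p 0); a (p 1); a (p 2)] i = a (p i).
  case: i => [[|[|[|//]]] lti]; rewrite (tnth_nth 0) /=; congr (a (p _));
    exact: val_inj.
by rewrite /form3_perm !bE !permKV.
Qed.

Definition sym_norm (R : realType) (n : nat) (Phi : form3 R n) : \bar R :=
  ereal_inf [set t | exists Psi : 'S_3 -> form3 R n,
    [/\ forall p, trilinear (Psi p),
        forall x y z, Phi x y z = \sum_(p : 'S_3) Psi p x y z &
        t = (\sum_(p : 'S_3) cb_norm (form3_perm (Psi p) p))%E]].

(* Main.v *)
Require Import Defs.
From HB Require Import structures.
From mathcomp Require Import all_boot all_order all_algebra all_fingroup.
From mathcomp Require Import all_classical all_reals all_analysis.
From mathcomp Require Import complex mxtens finfield ring lra.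

Set Implicit Arguments.
Unset Strict Implicit.
Unset Printing Implicit Defensive.

Import Order.TTheory GRing.Theory Num.Theory.

Local Open Scope classical_set_scope.
Local Open Scope ring_scope.

(** The example is the form
      Phi(a, b, c) = sum over x, y in F of phi(x, y) a_x b_y c_{x+y},
    where F is the field with N = 3^k elements (a trivial group if k = 0), k is
    maximal with N <= n, the phase is phi(x, y) = chi(x y^2) for a nontrivial
    additive character chi (and 1 if k = 0), and F is embedded in the index
    set.  The symmetrized norm of Phi is at least N^2, while its jointly completely bounded norm is O(N^(7/4)); as
    n < 3N, the quotient grows at least like n^(1/4).

    Lower bound ([sym_norm_ge]).  Let T be a tensor with entries of modulus at
    most one such that two indices of a point of its support determine the
    third.  Every slice of T is then a partial permutation matrix with
    contractive weights, so that pairing with T amounts to reading off one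
    matrix entry of the operator defining the cb norm, with matrix units
    X(i), Z(k) and the slices of T as Y(j).  The hypothesis on T is invariant
    under permuting the three indices, so the single functional T is dominated
    by all six cb norms at once, hence by the symmetrized norm.  The conjugate
    of the coefficient tensor of Phi is such a T, and it pairs with Phi to N^2.

    Upper bound ([jcb_norm_sum_form]).  This is a noncommutative generalized
    von Neumann inequality.  Tensor factors commute with each other and with
    each other's adjoints.  Discarding X by the triangle inequality, applying
    Cauchy-Schwarz over x and substituting y' = y + h, u = x + y regroups the
    result, for each shift h, into a form that is bilinear in a vector
    depending only on y and a vector depending only on u
    ([l2norm_triple_sum_le]).  Its coefficient matrix is
      a_h(y, u) = conj(phi(u - y, y)) phi(u - y, y + h);
    if its columns are orthogonal, the bilinear form is at most N^(3/2)
    ([bilinear_orthogonal_le]).  For the cubic phase, a_h(y, u) is chi(2huy)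
    times a function of y times a function of u, so orthogonality holds for all
    h != 0 ([cubic_uniform_phase]); the term h = 0 is at most N^2.
    Altogether the square of the norm is at most N (N^2 + N N^(3/2)). *)

(** * Moduli of complex numbers and real Cauchy-Schwarz *)

Section Modulus.
Context {R : realType}.
Local Notation normc := (@ComplexField.Normc.normc R).
Implicit Types z : R[i].

Lemma normc_norm z : (normc z)%:C%C = `|z|.
Proof. by []. Qed.

Lemma normc_real (x : R) : normc x%:C%C = `|x|.
Proof. by rewrite /= expr0n addr0 sqrtr_sqr. Qed.

Lemma normc_ge0 z : 0 <= normc z.
Proof. by case: z => a b; apply: sqrtr_ge0. Qed.

Lemma normc_sum (I : Type) (r : seq I) (P : pred I) (F : I -> R[i]) :
  normc (\sum_(i <- r | P i) F i) <= \sum_(i <- r | P i) normc (F i).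
Proof.
elim/big_rec2: _ => [|i y x _ le_xy]; first by rewrite ComplexField.Normc.normc0.
by apply: (le_trans (le_normcD _ _)); rewrite lerD2l.
Qed.

Lemma normc_sqr z : (normc z ^+ 2)%:C%C = (z^* * z)%C.
Proof. by rewrite rmorphXn/= normc_norm sqr_normc mulrC. Qed.

Lemma normc_conj z : normc (z^*)%C = normc z.
Proof. by apply: complexI; rewrite !normc_norm normcJ. Qed.

(** Lagrange's identity: twice the defect is the sum of the squares
    (a_i b_j - a_j b_i)^2. *)
Lemma sum_cauchy_schwarz (I : finType) (a b : I -> R) :
  (\sum_i a i * b i) ^+ 2 <= (\sum_i a i ^+ 2) * (\sum_i b i ^+ 2).
Proof.
have: 0 <= \sum_i \sum_j (a i * b j - a j * b i) ^+ 2.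
  by apply: sumr_ge0 => i _; apply: sumr_ge0 => j _; apply: sqr_ge0.
have -> : \sum_i \sum_j (a i * b j - a j * b i) ^+ 2 =
  \sum_i \sum_j (a i ^+ 2 * b j ^+ 2 + b i ^+ 2 * a j ^+ 2 
                 - ((a i * b i) * (a j * b j)) *+ 2).
  by apply: eq_bigr => i _; apply: eq_bigr => j _; ring.
under eq_bigr => i _ do rewrite sumrB big_split/= sumrMnl -!mulr_sumr.
rewrite sumrB big_split/= sumrMnl -!mulr_suml -expr2.
rewrite (mulrC (\sum_i b i ^+ 2)) -mulr2n -mulrnBl pmulrn_lge0//.
by rewrite subr_ge0.
Qed.

Lemma sum_sqr_le_card (I : finType) (a : I -> R) :
  (\sum_i a i) ^+ 2 <= #|I|%:R * \sum_i a i ^+ 2.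
Proof.
have := sum_cauchy_schwarz (fun=> 1) a.
under eq_bigr do rewrite mul1r.
by rewrite expr1n sumr_const.
Qed.

End Modulus.

(** * The Hilbert space of column vectors and its contractions *)

Section Hilbert.
Context {R : realType}.
Local Notation normc := (@ComplexField.Normc.normc R).
Local Notation C := R[i].

(** The conjugate transpose; [\adj] is the adjugate matrix. *)
Definition dag m n (A : 'M[C]_(m, n)) : 'M[C]_(n, m) := (map_mx conjc A)^T.

Lemma dagM m n p (A : 'M[C]_(m, n)) (B : 'M[C]_(n, p)) :
  dag (A *m B) = dag B *m dag A.
Proof. by rewrite /dag map_mxM trmx_mul. Qed.

Lemma dagK m n (A : 'M[C]_(m, n)) : dag (dag A) = A.
Proof. by apply/matrixP => i j; rewrite !mxE conjcK. Qed.

Lemma dagZ m n c (A : 'M[C]_(m, n)) : dag (c *: A) = (c^*)%C *: dag A.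
Proof. by apply/matrixP => i j; rewrite !mxE rmorphM. Qed.

Lemma dag_sum m n (I : Type) (r : seq I) (F : I -> 'M[C]_(m, n)) :
  dag (\sum_(i <- r) F i) = \sum_(i <- r) dag (F i).
Proof. by rewrite /dag !raddf_sum. Qed.

Definition dot d (u v : 'cV[C]_d) : C := (dag u *m v) 0 0.

Lemma dotE d (u v : 'cV[C]_d) : dot u v = \sum_i (u i 0)^*%C * v i 0.
Proof. by rewrite /dot mxE; apply: eq_bigr => i _; rewrite !mxE. Qed.

Lemma dot_mull m n (A : 'M[C]_(m, n)) u v : dot (A *m u) v = dot u (dag A *m v).
Proof. by rewrite /dot dagM mulmxA. Qed.

Lemma dot_mulr m n (A : 'M[C]_(m, n)) u v : dot u (A *m v) = dot (dag A *m u) v.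
Proof. by rewrite dot_mull dagK. Qed.

Lemma dotZl d c (u v : 'cV[C]_d) : dot (c *: u) v = c^*%C * dot u v.
Proof. by rewrite /dot dagZ -scalemxAl mxE. Qed.

Lemma dotZr d c (u v : 'cV[C]_d) : dot u (c *: v) = c * dot u v.
Proof. by rewrite /dot -scalemxAr mxE. Qed.

Lemma dot_suml d (I : Type) (r : seq I) (F : I -> 'cV[C]_d) v :
  dot (\sum_(i <- r) F i) v = \sum_(i <- r) dot (F i) v.
Proof. by rewrite /dot dag_sum mulmx_suml summxE. Qed.

Lemma dot_sumr d (I : Type) (r : seq I) u (F : I -> 'cV[C]_d) :
  dot u (\sum_(i <- r) F i) = \sum_(i <- r) dot u (F i).
Proof. by rewrite /dot mulmx_sumr summxE. Qed.

Lemma l2norm_ge0 d (v : 'cV[C]_d) : 0 <= l2norm v.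
Proof. exact: sqrtr_ge0. Qed.

Lemma l2norm_sqr d (v : 'cV[C]_d) :
  l2norm v ^+ 2 = \sum_i normc (v i 0) ^+ 2.
Proof. by rewrite sqr_sqrtr// sumr_ge0// => i _; rewrite sqr_ge0. Qed.

Lemma dotvv d (v : 'cV[C]_d) : dot v v = (l2norm v ^+ 2)%:C%C.
Proof.
rewrite dotE l2norm_sqr raddf_sum.
by apply: eq_bigr => i _; rewrite -normc_sqr.
Qed.

Lemma normc_dot d (u v : 'cV[C]_d) : normc (dot u v) <= l2norm u * l2norm v.
Proof.
rewrite -(@ler_pXn2r _ 2)// ?nnegrE ?mulr_ge0 ?normc_ge0 ?l2norm_ge0//.
rewrite exprMn !l2norm_sqr.
apply: le_trans (sum_cauchy_schwarz (fun i => normc (u i 0)) _).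
rewrite ler_pXn2r// ?nnegrE ?normc_ge0//; last first.
  by apply: sumr_ge0 => i _; rewrite mulr_ge0 ?normc_ge0.
rewrite dotE; apply: (le_trans (normc_sum _ _ _)).
by apply: ler_sum => i _; rewrite ComplexField.Normc.normcM normc_conj.
Qed.

Lemma l2norm_eq0 d (v : 'cV[C]_d) : l2norm v = 0 -> v = 0.
Proof.
move/(congr1 (fun x => x ^+ 2)); rewrite l2norm_sqr expr0n/= => /eqP.
rewrite psumr_eq0 => [/allP v0|i _]; last exact: sqr_ge0.
apply/matrixP => i j; rewrite ord1 mxE.
apply: ComplexField.Normc.eq0_normc; apply/eqP; rewrite -sqrf_eq0.
by apply: v0; rewrite mem_index_enum.
Qed.

Lemma l2normZ d c (v : 'cV[C]_d) : l2norm (c *: v) = normc c * l2norm v.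
Proof.
apply/eqP; rewrite -(@eqrXn2 _ 2)// ?mulr_ge0 ?normc_ge0 ?l2norm_ge0//.
rewrite exprMn !l2norm_sqr mulr_sumr; apply/eqP; apply: eq_bigr => i _.
by rewrite mxE ComplexField.Normc.normcM exprMn.
Qed.

(** The bound is attained at [v / l2norm v].  Duality is the source of the
    triangle inequality and of the contractivity of adjoints. *)
Lemma l2norm_le_dot d (v : 'cV[C]_d) (c : R) : 0 <= c ->
  (forall u, l2norm u <= 1 -> normc (dot u v) <= c) -> l2norm v <= c.
Proof.
move=> c0 le_c; have [->//|v0] := eqVneq (l2norm v) 0.
have vp : 0 < l2norm v by rewrite lt_def v0 l2norm_ge0.
have := le_c (((l2norm v)^-1)%:C%C *: v).
have nV : normc ((l2norm v)^-1)%:C%C = (l2norm v)^-1.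
  by rewrite normc_real ger0_norm ?invr_ge0 ?l2norm_ge0.
rewrite l2normZ dotZl ComplexField.Normc.normcM normc_conj nV dotvv mulVf//.
rewrite normc_real ger0_norm ?sqr_ge0// expr2 mulKf//.
exact.
Qed.

Lemma l2norm_sum d (I : Type) (r : seq I) (F : I -> 'cV[C]_d) :
  l2norm (\sum_(i <- r) F i) <= \sum_(i <- r) l2norm (F i).
Proof.
apply: l2norm_le_dot => [|u u1].
  by apply: sumr_ge0 => i _; exact: l2norm_ge0.
rewrite dot_sumr; apply: (le_trans (normc_sum _ _ _)); apply: ler_sum => i _.
apply: (le_trans (normc_dot _ _)).
by rewrite ler_piMl ?l2norm_ge0.
Qed.

Lemma l2norm_sum_sqr d (I : finType) (F : I -> 'cV[C]_d) :
  (l2norm (\sum_i F i) ^+ 2)%:C%C = \sum_i \sum_j dot (F i) (F j).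
Proof.
by rewrite -dotvv dot_suml; apply: eq_bigr => i _; rewrite dot_sumr.
Qed.

(** Homogeneous form of [mxball], in terms of real numbers only. *)
Definition contractive d (A : 'M[C]_d) : Prop :=
  forall v, l2norm (A *m v) <= l2norm v.

Lemma mxballP d (A : 'M[C]_d) : mxball A <-> contractive A.
Proof.
split=> [A1 v|cA]; last first.
  rewrite /mxball/= /opnorm; apply: ge_ereal_sup => _ [v /= v1 <-].
  by rewrite lee_fin (le_trans (cA v)).
have [v0|v0] := eqVneq (l2norm v) 0.
  by rewrite (l2norm_eq0 v0) mulmx0.
have vp : 0 < l2norm v by rewrite lt_def v0 l2norm_ge0.
pose c := ((l2norm v)^-1)%:C%C.
have nc : normc c = (l2norm v)^-1.
  by rewrite normc_real ger0_norm ?invr_ge0 ?l2norm_ge0.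
have : ((l2norm (A *m (c *: v)))%:E <= 1)%E.
  apply: (le_trans _ A1); apply: ereal_sup_ubound; exists (c *: v) => //=.
  by rewrite l2normZ nc mulVf.
by rewrite lee_fin -scalemxAr l2normZ nc ler_pdivrMl// mulr1.
Qed.

Lemma contractive_dag d (A : 'M[C]_d) : contractive A -> contractive (dag A).
Proof.
move=> cA v; apply: l2norm_le_dot => [|u u1]; first exact: l2norm_ge0.
rewrite dot_mulr dagK (le_trans (normc_dot _ _))//.
by rewrite ler_piMl ?l2norm_ge0// (le_trans (cA u)).
Qed.

End Hilbert.

(** * Amplifications *)

Section Tensor.
Context {R : realType}.
Local Notation normc := (@ComplexField.Normc.normc R).
Local Notation C := R[i].

Lemma sum_mxtens (V : nmodType) m n (F : 'I_(m * n) -> V) :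
  \sum_k F k = \sum_i \sum_j F (mxtens_index (i, j)).
Proof.
rewrite pair_bigA/= (reindex (@mxtens_index m n)); last first.
  by exists (@mxtens_unindex m n) => k _; rewrite ?mxtens_indexK ?mxtens_unindexK.
by apply: eq_bigr => -[i j].
Qed.

Lemma contractive_tens1 m n (A : 'M[C]_m) :
  contractive A -> contractive (A *t (1%:M : 'M[C]_n)).
Proof.
move=> cA v; rewrite -(@ler_pXn2r _ 2)// ?nnegrE ?l2norm_ge0//.
rewrite !l2norm_sqr !sum_mxtens exchange_big [leRHS]exchange_big.
apply: ler_sum => j _.
pose w := \col_i v (mxtens_index (i, j)) 0.
have -> : \sum_i normc (v (mxtens_index (i, j)) 0) ^+ 2 = l2norm w ^+ 2.
  by rewrite l2norm_sqr; apply: eq_bigr => i _; rewrite mxE.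
rewrite (_ : \sum_i _ = l2norm (A *m w) ^+ 2).
  by rewrite ler_pXn2r ?nnegrE ?l2norm_ge0//; exact: cA.
rewrite l2norm_sqr; apply: eq_bigr => i _; congr (normc _ ^+ 2).
rewrite !mxE sum_mxtens; apply: eq_bigr => i' _; rewrite (bigD1 j)//= big1.
  by rewrite tensmxE !mxE eqxx mulr1 addr0.
by move=> j' /negPf nj; rewrite tensmxE !mxE eq_sym nj mulr0 mul0r.
Qed.

Lemma contractive_1tens m n (A : 'M[C]_n) :
  contractive A -> contractive ((1%:M : 'M[C]_m) *t A).
Proof.
move=> cA v; rewrite -(@ler_pXn2r _ 2)// ?nnegrE ?l2norm_ge0//.
rewrite !l2norm_sqr !sum_mxtens.
apply: ler_sum => i _.
pose w := \col_j v (mxtens_index (i, j)) 0.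
have -> : \sum_j normc (v (mxtens_index (i, j)) 0) ^+ 2 = l2norm w ^+ 2.
  by rewrite l2norm_sqr; apply: eq_bigr => j _; rewrite mxE.
rewrite (_ : \sum_j _ = l2norm (A *m w) ^+ 2).
  by rewrite ler_pXn2r ?nnegrE ?l2norm_ge0//; exact: cA.
rewrite l2norm_sqr; apply: eq_bigr => j _; congr (normc _ ^+ 2).
rewrite !mxE sum_mxtens (bigD1 i)//= [X in _ + X]big1 ?addr0.
  by apply: eq_bigr => j' _; rewrite tensmxE !mxE eqxx mul1r.
move=> i' /negPf ni; apply: big1 => j' _.
by rewrite tensmxE !mxE eq_sym ni !mul0r.
Qed.

Lemma dag_tens m n p q (A : 'M[C]_(m, n)) (B : 'M[C]_(p, q)) :
  dag (A *t B) = dag A *t dag B.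
Proof. by rewrite /dag map_mxT trmx_tens. Qed.

Lemma dag1 n : dag (1%:M : 'M[C]_n) = 1%:M.
Proof. by rewrite /dag map_mx1 trmx1. Qed.

Lemma tens1 m n : (1%:M : 'M[C]_m) *t (1%:M : 'M[C]_n) = 1%:M.
Proof.
apply/matrixP => i j; rewrite -(mxtens_unindexK i) -(mxtens_unindexK j).
case: (mxtens_unindex i) (mxtens_unindex j) => i1 i2 [j1 j2].
by rewrite tensmxE !mxE (can_eq (@mxtens_indexK _ _)) xpair_eqE -natrM mulnb.
Qed.

End Tensor.

(** * The generalized von Neumann inequality *)

Section VonNeumann.
Context {R : realType}.
Local Notation normc := (@ComplexField.Normc.normc R).
Local Notation C := R[i].
Context (G : finZmodType) (phi : G -> G -> C).
Local Notation N := (#|G|%:R : R).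

(** The discrete derivative of [phi] in direction [h] of its second variable, in
    the coordinates [y] and [u = x + y] that separate the two remaining operator
    families. *)
Definition diff_kernel (h y u : G) : C :=
  (phi (u - y) y)^*%C * phi (u - y) (y + h).

(** The operators [X x] cost nothing because the vector that they act on depends
    on [x] alone.  After Cauchy-Schwarz over [x], the inner product of the
    summands [y] and [y + h] contains [Z (x + y)] and [Z (x + y + h)]; moving
    all [Y] to the left entry and all [Z] to the right one, which is where
    commutation with adjoints is used, makes the left entry independent of [u]
    and the right one independent of [y]. *)
Lemma l2norm_triple_sum_le D (X Y Z : G -> 'M[C]_D) (eta : 'cV[C]_D) :
  (forall x, contractive (X x)) ->
  (forall y z, Z z *m Y y = Y y *m Z z) ->
  (forall y z, Z z *m dag (Y y) = dag (Y y) *m Z z) ->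
  l2norm (\sum_x \sum_y phi x y *: (X x *m Y y *m Z (x + y)) *m eta) ^+ 2 <=
  N * \sum_h normc (\sum_y \sum_u diff_kernel h y u *
     dot (dag (Y (y + h)) *m (Y y *m eta)) (dag (Z u) *m (Z (u + h) *m eta))).
Proof.
move=> cX YZ YdagZ.
pose g x : 'cV_D := \sum_y phi x y *: (Y y *m (Z (x + y) *m eta)).
have XgE x : \sum_y phi x y *: (X x *m Y y *m Z (x + y)) *m eta = X x *m g x.
  rewrite mulmx_sumr; apply: eq_bigr => y _.
  by rewrite -scalemxAl -scalemxAr !mulmxA.
under eq_bigr do rewrite XgE.
have le1 : l2norm (\sum_x X x *m g x) <= \sum_x l2norm (g x).
  apply: (le_trans (l2norm_sum _ _)); apply: ler_sum => x _; exact: cX.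
apply: (@le_trans _ _ ((\sum_x l2norm (g x)) ^+ 2)).
  by rewrite ler_pXn2r ?nnegrE ?l2norm_ge0// sumr_ge0// => x _; exact: l2norm_ge0.
apply: (le_trans (sum_sqr_le_card _)); rewrite ler_wpM2l//.
set S := \sum_h _.
suff -> : \sum_x l2norm (g x) ^+ 2 =
    normc (\sum_h \sum_y \sum_u diff_kernel h y u *
     dot (dag (Y (y + h)) *m (Y y *m eta)) (dag (Z u) *m (Z (u + h) *m eta))).
  exact: normc_sum.
(* The left side is nonnegative, so the identity may be proved inside the modulus
   and in C. *)
have -> (z : C) (x : R) : x = normc z <-> x%:C%C = `|z|.
  by split=> [->//|/complexI].
rewrite -[LHS]ger0_norm; last first.
  by rewrite ler0c sumr_ge0// => x _; rewrite sqr_ge0.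
congr `|_|; rewrite raddf_sum/=.
under eq_bigr => x _ do rewrite l2norm_sum_sqr.
transitivity (\sum_x \sum_y \sum_h (phi x y)^*%C * phi x (y + h) *
   dot (Y y *m (Z (x + y) *m eta)) (Y (y + h) *m (Z (x + y + h) *m eta))).
  apply: eq_bigr => x _; apply: eq_bigr => y _.
  rewrite (reindex_inj (addrI y)); apply: eq_bigr => h _.
  by rewrite dotZl dotZr mulrA addrA.
transitivity (\sum_y \sum_h \sum_x (phi x y)^*%C * phi x (y + h) *
   dot (Y y *m (Z (x + y) *m eta)) (Y (y + h) *m (Z (x + y + h) *m eta))).
  by rewrite exchange_big; apply: eq_bigr => y _; rewrite exchange_big.
rewrite exchange_big; apply: eq_bigr => h _; apply: eq_bigr => y _.
rewrite (reindex_inj (addIr (- y))); apply: eq_bigr => u _ /=.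
rewrite /diff_kernel subrK; congr (_ * _).
rewrite dot_mulr (mulmxA (Y y)) -YZ -!mulmxA (mulmxA (dag _)) -YdagZ.
by rewrite -mulmxA dot_mull.
Qed.

End VonNeumann.

(** * The jcb norm of forms supported on an addition table *)

Section JcbBound.
Context {R : realType}.
Local Notation normc := (@ComplexField.Normc.normc R).
Local Notation C := R[i].

(** The matrix [a] is [sqrt #|I|] times a unitary, and the two families of vectors
    have Hilbert-Schmidt norm at most [sqrt #|I|] each. *)
Lemma bilinear_orthogonal_le (I : finType) D (a : I -> I -> C)
    (w v : I -> 'cV[C]_D) :
  (forall y u, normc (a y u) = 1) ->
  (forall u u', u != u' -> \sum_y (a y u)^*%C * a y u' = 0) ->
  (forall y, l2norm (w y) <= 1) -> (forall u, l2norm (v u) <= 1) ->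
  normc (\sum_y \sum_u a y u * dot (w y) (v u)) ^+ 2 <= #|I|%:R ^+ 3.
Proof.
move=> a1 orth w1 v1; pose g y := \sum_u a y u *: v u.
have le1 : normc (\sum_y \sum_u a y u * dot (w y) (v u)) <= \sum_y l2norm (g y).
  apply: (le_trans (normc_sum _ _ _)); apply: ler_sum => y _.
  rewrite (_ : \sum_u _ = dot (w y) (g y)).
    by apply: (le_trans (normc_dot _ _)); rewrite ler_piMl ?l2norm_ge0.
  by rewrite dot_sumr; apply: eq_bigr => u _; rewrite dotZr.
apply: (@le_trans _ _ ((\sum_y l2norm (g y)) ^+ 2)).
  rewrite ler_pXn2r ?nnegrE ?normc_ge0// sumr_ge0// => y _; exact: l2norm_ge0.
apply: (le_trans (sum_sqr_le_card _)); rewrite exprS ler_wpM2l//.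
have -> : \sum_y l2norm (g y) ^+ 2 = \sum_u #|I|%:R * l2norm (v u) ^+ 2.
  apply: complexI; rewrite !raddf_sum/=.
  under eq_bigr => y _ do rewrite l2norm_sum_sqr.
  transitivity (\sum_u \sum_u' (\sum_y (a y u)^*%C * a y u') * dot (v u) (v u')).
    rewrite exchange_big; apply: eq_bigr => u _; rewrite exchange_big.
    apply: eq_bigr => u' _; rewrite mulr_suml; apply: eq_bigr => y _.
    by rewrite dotZl dotZr mulrA.
  apply: eq_bigr => u _; rewrite (bigD1 u)//= [X in _ + X]big1 ?addr0; last first.
    by move=> u' nu; rewrite orth ?mul0r// eq_sym.
  rewrite dotvv [RHS](rmorphM (real_complex R)); congr (_ * _).
  under eq_bigr => y _ do rewrite -normc_sqr a1 expr1n.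
  by rewrite sumr_const; apply: esym; exact: (rmorph_nat (real_complex R)).
rewrite -mulr_sumr expr2 ler_wpM2l//.
rewrite -sum1_card natr_sum; apply: ler_sum => u _.
by rewrite expr_le1 ?l2norm_ge0.
Qed.

Context (G : finZmodType) (phi : G -> G -> C).
Local Notation N := (#|G|%:R : R).

(** Orthogonality of the columns of all nontrivial derivatives; this is the only
    pseudorandomness of [phi] that the upper bound relies on. *)
Definition uniform_phase : Prop :=
  [/\ forall x y, normc (phi x y) = 1 &
      forall h u u' : G, h != 0 -> u != u' ->
        \sum_y (diff_kernel phi h y u)^*%C * diff_kernel phi h y u' = 0].

Definition sum_form n (iota : G -> 'I_n) : form3 R n := fun a b c =>
  \sum_x \sum_y phi x y * a 0 (iota x) * b 0 (iota y) * c 0 (iota (x + y)).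

Lemma sum_form_trilinear n (iota : G -> 'I_n) : trilinear (sum_form iota).
Proof.
split=> [y z|x z|x y] k u v; rewrite /sum_form mulr_sumr -big_split/=;
  apply: eq_bigr => g _; rewrite mulr_sumr -big_split/=; apply: eq_bigr => h _;
  rewrite !mxE; ring.
Qed.

Lemma sum_form_coef n (iota : G -> 'I_n) i j k :
  sum_form iota (stdb R i) (stdb R j) (stdb R k) =
  \sum_x \sum_y phi x y *
    ((iota x == i) && (iota y == j) && (iota (x + y) == k))%:R.
Proof.
rewrite /sum_form; apply: eq_bigr => x _; apply: eq_bigr => y _.
by rewrite !mxE !eqxx/= -!mulrA -!natrM !mulnb andbA.
Qed.

(** Evaluating the form on operators only involves the addition table; several
    points of the table may have the same image when [iota] is not injective. *)
Lemma sum_form_apply n (iota : G -> 'I_n) (V : lmodType C)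
    (M : 'I_n -> 'I_n -> 'I_n -> V) :
  \sum_i \sum_j \sum_k
    sum_form iota (stdb R i) (stdb R j) (stdb R k) *: M i j k =
  \sum_x \sum_y phi x y *: M (iota x) (iota y) (iota (x + y)).
Proof.
under eq_bigr => i _ do under eq_bigr => j _ do under eq_bigr => k _ do
  rewrite sum_form_coef pair_bigA/= scaler_suml.
under eq_bigr => i _ do under eq_bigr => j _ do rewrite exchange_big/=.
under eq_bigr => i _ do rewrite exchange_big/=.
rewrite exchange_big/= [RHS]pair_bigA/=; apply: eq_bigr => -[x y] _ /=.
rewrite (bigD1 (iota x))//= (bigD1 (iota y))//= (bigD1 (iota (x + y)))//=.
rewrite !eqxx mulr1 !big1 ?addr0// => [i ni|j nj|k nk].
- by apply: big1 => j _; apply: big1 => k _;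
    rewrite eq_sym (negPf ni) mulr0 scale0r.
- by apply: big1 => k _; rewrite (eq_sym _ j) (negPf nj) andbF mulr0 scale0r.
- by rewrite (eq_sym _ k) (negPf nk) andbF mulr0 scale0r.
Qed.

(** With [s = sqrt N], the von Neumann inequality bounds the square of the norm by
    [s^2] times the sum of [s^4] for the shift zero and at most [s^2 * s^3] for
    the other shifts; [s >= 1] turns this into [2 s^7]. *)
Lemma jcb_norm_sum_form n (iota : G -> 'I_n) : uniform_phase ->
  (jcb_norm (sum_form iota) <= (Num.sqrt (2 * Num.sqrt N ^+ 7))%:E)%E.
Proof.
move=> [phi1 phi_orth]; apply: ge_ereal_sup => _ [d [X [Y [Z [_ bX bY bZ ->]]]]].
have {bX} cX i : contractive (X i) by apply/mxballP.
have {bY} cY i : contractive (Y i) by apply/mxballP.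
have {bZ} cZ i : contractive (Z i) by apply/mxballP.
apply: ge_ereal_sup => _ [eta /= eta1 <-]; rewrite lee_fin.
have s1 : 1 <= Num.sqrt N.
  by rewrite -[leLHS]sqrtr1 ler_wsqrtr// ler1n; apply/card_gt0P; exists 0.
have sN : Num.sqrt N ^+ 2 = N by rewrite sqr_sqrtr.
set s := Num.sqrt N in s1 sN *; have s0 : 0 <= s by apply: le_trans s1.
rewrite -[leLHS]ger0_norm ?l2norm_ge0// -sqrtr_sqr ler_wsqrtr//.
rewrite sum_form_apply mulmx_suml.
pose X' x := X (iota x) *t (1%:M : 'M[C]_d) *t (1%:M : 'M[C]_d).
pose Y' x := (1%:M : 'M[C]_d) *t Y (iota x) *t (1%:M : 'M[C]_d).
pose Z' x := (1%:M : 'M[C]_d) *t (1%:M : 'M[C]_d) *t Z (iota x).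
have cX' x : contractive (X' x) by apply/contractive_tens1/contractive_tens1.
have cY' x : contractive (Y' x) by apply/contractive_tens1/contractive_1tens.
have cZ' x : contractive (Z' x) by rewrite /Z' tens1; apply: contractive_1tens.
have -> :
    \sum_x (\sum_y phi x y *:
      (X (iota x) *t Y (iota y) *t Z (iota (x + y)))) *m eta
    = \sum_x \sum_y phi x y *: (X' x *m Y' y *m Z' (x + y)) *m eta.
  apply: eq_bigr => x _; rewrite mulmx_suml; apply: eq_bigr => y _.
  by rewrite !tensmx_mul !mulmx1 !mul1mx.
apply: (le_trans (l2norm_triple_sum_le phi eta cX' _ _)).
- by move=> y z; rewrite !tensmx_mul !mulmx1 !mul1mx.
- by move=> y z; rewrite !dag_tens !dag1 !tensmx_mul !mulmx1 !mul1mx.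
rewrite -sN [leRHS](_ : _ = s ^+ 2 * (s ^+ 5 + s ^+ 5)); last by ring.
rewrite ler_wpM2l ?sqr_ge0//.
have y1 h y : l2norm (dag (Y' (y + h)) *m (Y' y *m eta)) <= 1.
  by apply: le_trans (contractive_dag (cY' _) _) _; apply: le_trans (cY' _ _) _.
have z1 h u : l2norm (dag (Z' u) *m (Z' (u + h) *m eta)) <= 1.
  by apply: le_trans (contractive_dag (cZ' _) _) _; apply: le_trans (cZ' _ _) _.
have k1 h y u : normc (diff_kernel phi h y u) = 1.
  by rewrite ComplexField.Normc.normcM normc_conj !phi1 mulr1.
have sumN (c : R) : \sum_(g : G) c = s ^+ 2 * c.
  by rewrite sumr_const sN mulr_natl.
(* Shift zero: no cancellation is available. *)
rewrite (bigD1 0)//=; apply: lerD.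
  apply: (@le_trans _ _ (s ^+ 4)); last by rewrite ler_weXn2l.
  have -> : s ^+ 4 = \sum_(y : G) \sum_(u : G) 1.
    by rewrite !sumN; ring.
  do 2!(apply: (le_trans (normc_sum _ _ _)); apply: ler_sum => ? _).
  rewrite ComplexField.Normc.normcM k1 mul1r (le_trans (normc_dot _ _))//.
  by rewrite mulr_ile1 ?l2norm_ge0.
apply: (@le_trans _ _ (\sum_(h : G) s ^+ 3)); last by rewrite sumN -exprD.
rewrite [leRHS](bigD1 0)//= ler_wpDl ?exprn_ge0//; apply: ler_sum => h h0.
rewrite -(@ler_pXn2r _ 2)// ?nnegrE ?normc_ge0 ?exprn_ge0// [leRHS]exprAC sN.
exact: bilinear_orthogonal_le (fun u u' => phi_orth h u u' h0) (y1 h) (z1 h).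
Qed.

End JcbBound.

(** * Lower bounds for the symmetrized norm *)

Section SymBound.
Context {R : realType}.
Local Notation normc := (@ComplexField.Normc.normc R).
Local Notation C := R[i].

(** Each row acts on at most one coordinate, and no coordinate is used by two
    rows. *)
Lemma contractive_partial_perm d (A : 'M[C]_d) :
  (forall i k, normc (A i k) <= 1) ->
  (forall i k k', A i k != 0 -> A i k' != 0 -> k = k') ->
  (forall i i' k, A i k != 0 -> A i' k != 0 -> i = i') ->
  contractive A.
Proof.
move=> A1 Arow Acol v; rewrite -(@ler_pXn2r _ 2)// ?nnegrE ?l2norm_ge0//.
rewrite !l2norm_sqr.
apply: (@le_trans _ _ (\sum_i \sum_k (A i k != 0)%:R * normc (v k 0) ^+ 2)).
  apply: ler_sum => i _; rewrite mxE.
  case: (pickP (fun k => A i k != 0)) => [k Aik|Ai0]; last first.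
    rewrite big1 ?ComplexField.Normc.normc0 ?expr0n/=.
      by apply: sumr_ge0 => k _; rewrite mulr_ge0// sqr_ge0.
    by move=> k _; have /negbFE/eqP -> := Ai0 k; rewrite mul0r.
  rewrite (bigD1 k)//= big1 ?addr0 => [|k' nk]; last first.
    have [->|A'] := eqVneq (A i k') 0; first by rewrite mul0r.
    by rewrite (Arow _ _ _ Aik A') eqxx in nk.
  rewrite (bigD1 k)//= Aik mul1r ler_wpDr//.
    by apply: sumr_ge0 => k' _; rewrite mulr_ge0// sqr_ge0.
  rewrite ler_pXn2r ?nnegrE ?normc_ge0// ComplexField.Normc.normcM.
  by rewrite ler_piMl ?normc_ge0.
rewrite exchange_big; apply: ler_sum => k _; rewrite -mulr_suml.
rewrite ler_piMl ?sqr_ge0//.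
case: (pickP (fun i => A i k != 0)) => [i Aik|Ak0].
  rewrite (bigD1 i)//= Aik big1 ?addr0// => i' ni.
  have [//|A'] := eqVneq (A i' k) 0.
  by rewrite (Acol _ _ _ Aik A') eqxx in ni.
by rewrite big1// => i _; rewrite Ak0.
Qed.

Lemma contractive_delta d (i j : 'I_d) : contractive (delta_mx i j : 'M[C]_d).
Proof.
apply: contractive_partial_perm => [a b|a b b'|a a' b]; rewrite !mxE.
- by case: (_ && _); rewrite ?ComplexField.Normc.normc0 ?ComplexField.Normc.normc1.
- case: (a == i) => //=; rewrite ?eqxx//=.
  case: (b =P j) => [->|_]; rewrite ?eqxx//.
  by case: (b' =P j) => [->|_]; rewrite ?eqxx.
- case: (a =P i) => [->|_]; rewrite /= ?eqxx//.
  by case: (a' =P i) => [->|_]; rewrite /= ?eqxx.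
Qed.

Lemma l2norm_delta d (i : 'I_d) : l2norm (delta_mx i 0 : 'cV[C]_d) = 1.
Proof.
rewrite /l2norm (bigD1 i)//= big1 => [|j nj]; rewrite !mxE ?eqxx.
  by rewrite ComplexField.Normc.normc1 expr1n addr0 sqrtr1.
by rewrite (negPf nj) ComplexField.Normc.normc0 expr0n.
Qed.

Definition triple n (i j k : 'I_n) : {ffun 'I_3 -> 'I_n} :=
  [ffun a => tnth [tuple i; j; k] a].

Lemma tripleE n i j k : ((@triple n i j k) 0 = i) * ((@triple n i j k) 1 = j) *
   ((@triple n i j k) 2 = k).
Proof. by rewrite !ffunE. Qed.

Lemma triple_eta n (f : {ffun 'I_3 -> 'I_n}) : triple (f 0) (f 1) (f 2) = f.
Proof.
apply/ffunP => a; rewrite ffunE.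
case: a => [[|[|[|//]]] lta]; rewrite (tnth_nth (f 0)) /=;
  congr (f _); exact: val_inj.
Qed.

Lemma sum_triple n (V : nmodType) (F : {ffun 'I_3 -> 'I_n} -> V) :
  \sum_f F f = \sum_i \sum_j \sum_k F (triple i j k).
Proof.
rewrite pair_bigA/= pair_bigA/=.
rewrite (reindex (fun q : 'I_n * 'I_n * 'I_n => triple q.1.1 q.1.2 q.2))//=.
exists (fun f => (f 0, f 1, f 2)) => [[[i j] k] _|f _] /=.
  by rewrite !tripleE.
exact: triple_eta.
Qed.

(** Multi-indices are functions on ['I_3], on which permutations act by
    precomposition. *)
Definition coef n (Phi : form3 R n) (f : {ffun 'I_3 -> 'I_n}) : C :=
  Phi (stdb R (f 0)) (stdb R (f 1)) (stdb R (f 2)).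

(** The support is a partial Latin square, a condition that treats the three
    positions alike: this symmetry is what makes one test tensor serve all six
    orders of multiplication. *)
Definition partial_latin n (T : {ffun 'I_3 -> 'I_n} -> C) : Prop :=
  (forall f, normc (T f) <= 1) /\
  (forall a f g, T f != 0 -> T g != 0 ->
    (forall b, b != a -> f b = g b) -> f = g).

(** With [X i] the matrix unit [E_{0 i}], [Z k] the matrix unit [E_{k 0}] and
    [Y j] the [j]-th slice of [T], the operator in the definition of the cb norm
    is the pairing of [Phi] and [T] times [E_{0 0}]. *)
Lemma cb_norm_ge n (Phi : form3 R n) (T : {ffun 'I_3 -> 'I_n} -> C) :
  (0 < n)%N -> partial_latin T ->
  ((normc (\sum_f coef Phi f * T f))%:E <= cb_norm Phi)%E.
Proof.
case: n Phi T => // n Phi T _ [T1 Tlatin].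
pose Y j : 'M[C]_n.+1 := \matrix_(i, k) T (triple i j k).
apply: (@le_trans _ _ (opnorm (\sum_i \sum_j \sum_k
    Phi (stdb R i) (stdb R j) (stdb R k) *:
       (delta_mx 0 i *m Y j *m delta_mx k 0)))); last first.
  apply: ereal_sup_ubound.
  exists n.+1, (fun i => delta_mx 0 i), Y, (fun k => delta_mx k 0).
  split=> // [i|j|k]; apply/mxballP; try exact: contractive_delta.
  apply: contractive_partial_perm => [i k|i k k'|i i' k]; rewrite !mxE//.
    move=> nz nz'; rewrite -[LHS](tripleE i j k).2 -[RHS](tripleE i j k').2.
    congr (fun_of_fin _ _); apply: (Tlatin 2) => // b.
    by case: b => [[|[|[|//]]] ltb] // _; rewrite !ffunE !(tnth_nth i).
  move=> nz nz'; rewrite -[LHS](tripleE i j k).1.1 -[RHS](tripleE i' j k).1.1.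
  congr (fun_of_fin _ _); apply: (Tlatin 0) => // b.
  by case: b => [[|[|[|//]]] ltb] // _; rewrite !ffunE !(tnth_nth i).
have -> : \sum_i \sum_j \sum_k Phi (stdb R i) (stdb R j) (stdb R k) *:
       (delta_mx 0 i *m Y j *m delta_mx k 0) =
   (\sum_f coef Phi f * T f) *: (delta_mx 0 0 : 'M[C]_n.+1).
  rewrite sum_triple scaler_suml; apply: eq_bigr => i _.
  rewrite scaler_suml; apply: eq_bigr => j _.
  rewrite scaler_suml; apply: eq_bigr => k _.
  rewrite /coef !tripleE -scalerA; congr (_ *: _).
  apply/matrixP => a b; rewrite !mxE (bigD1 k)//= big1 ?addr0 => [|k' nk].
    rewrite !mxE (bigD1 i)//= big1 ?addr0 => [|i' ni].
      by rewrite !mxE !eqxx andbT mulrAC -natrM mulnb mulrC.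
    by rewrite !mxE (negPf ni) andbF mul0r.
  by rewrite !mxE (negPf nk) mulr0.
apply: ereal_sup_ubound; exists (delta_mx 0 0) => /=.
  by rewrite (l2norm_delta 0).
rewrite -scalemxAl l2normZ mul_delta_mx (l2norm_delta 0) mulr1//.
Qed.

(** Pairing [Psi p] with [T] is pairing its permuted form with the permuted [T],
    which is again partial Latin. *)
Lemma sym_norm_ge n (Phi : form3 R n) (T : {ffun 'I_3 -> 'I_n} -> C) :
  (0 < n)%N -> partial_latin T ->
  ((normc (\sum_f coef Phi f * T f))%:E <= sym_norm Phi)%E.
Proof.
move=> n0 [T1 Tlatin]; apply: le_ereal_inf_tmp => _ [Psi [_ PhiE ->]].
pose tw (p : 'S_3) (f : {ffun 'I_3 -> 'I_n}) : {ffun 'I_3 -> 'I_n} :=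
  [ffun a => f (p a)].
have twK p : cancel (tw p) (tw p^-1%g).
  by move=> f; apply/ffunP => a; rewrite !ffunE permKV.
have twVK p : cancel (tw p^-1%g) (tw p).
  by move=> f; apply/ffunP => a; rewrite !ffunE permK.
have -> : \sum_f coef Phi f * T f =
    \sum_p \sum_f coef (form3_perm (Psi p) p) f * T (tw p^-1%g f).
  transitivity (\sum_p \sum_f coef (Psi p) f * T f).
    rewrite exchange_big; apply: eq_bigr => f _ /=.
    by rewrite -mulr_suml; congr (_ * _); exact: PhiE.
  apply: eq_bigr => p _; rewrite [RHS](reindex_inj (can_inj (twK p))).
  apply: eq_bigr => f _; rewrite twK; congr (_ * _).
  by rewrite /coef !ffunE (form3_permE (Psi p) p (fun a => stdb R (f a))).
apply: (@le_trans _ _ (\sum_p (normc (\sum_f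
    coef (form3_perm (Psi p) p) f * T (tw p^-1%g f)))%:E)%E).
  by rewrite sumEFin lee_fin; exact: normc_sum.
apply: lee_sum => p _; apply: cb_norm_ge => //; split=> [f|a f g nf ng fg].
  exact: T1.
apply: (can_inj (twVK p)).
apply: (Tlatin (p a)) => // b nb; rewrite !ffunE fg//.
by apply: contra nb => /eqP <-; rewrite permKV.
Qed.

End SymBound.

(** * The symmetrized norm of forms supported on an addition table *)

Section SumFormSym.
Context {R : realType}.
Local Notation normc := (@ComplexField.Normc.normc R).
Local Notation C := R[i].
Context (G : finZmodType) (phi : G -> G -> C) (n : nat) (iota : G -> 'I_n).
Context (phi1 : forall x y, normc (phi x y) = 1) (iota_inj : injective iota).
Local Notation Phi := (sum_form phi iota).

Lemma coef_sum_form_graph x y :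
  coef Phi (triple (iota x) (iota y) (iota (x + y))) = phi x y.
Proof.
rewrite /coef !tripleE sum_form_coef (bigD1 x)//= (bigD1 y)//= !eqxx mulr1.
rewrite !big1 ?addr0// => [x' nx|y' ny].
  by apply: big1 => y' _; rewrite (inj_eq iota_inj) (negPf nx) mulr0.
by rewrite (inj_eq iota_inj) (negPf ny) andbF mulr0.
Qed.

Lemma coef_sum_form_neq0 f : coef Phi f != 0 ->
  exists x y, f = triple (iota x) (iota y) (iota (x + y)).
Proof.
move=> nz; have [/existsP[x /existsP[y /eqP fE]]|/existsPn none] :=
  boolP [exists x, exists y, f == triple (iota x) (iota y) (iota (x + y))].
  by exists x, y.
case/eqP: nz; rewrite /coef sum_form_coef big1// => x _; rewrite big1// => y _.
have [/andP[/andP[/eqP e0 /eqP e1] /eqP e2]|_] := boolP (_ && _); last by rewrite mulr0.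
have /existsPn/(_ y)/eqP[] := none x.
by rewrite e0 e1 e2 triple_eta.
Qed.

Lemma partial_latin_sum_form : partial_latin (fun f => (coef Phi f)^*%C).
Proof.
split=> [f|a f g]; rewrite ?normc_conj ?conjc_eq0.
  have [->|/coef_sum_form_neq0[x [y ->]]] := eqVneq (coef Phi f) 0.
    by rewrite ComplexField.Normc.normc0.
  by rewrite coef_sum_form_graph phi1.
move=> /coef_sum_form_neq0[x [y ->]] /coef_sum_form_neq0[x' [y' ->]].
case: a => [[|[|[|//]]] lta] eqb.
- have := eqb 2 isT; have := eqb 1 isT; rewrite !tripleE.
  by move=> /iota_inj -> /iota_inj e; rewrite (addIr _ e).
- have := eqb 2 isT; have := eqb 0 isT; rewrite !tripleE.
  by move=> /iota_inj -> /iota_inj e; rewrite (addrI _ e).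
- have := eqb 0 isT; have := eqb 1 isT; rewrite !tripleE.
  by move=> /iota_inj -> /iota_inj ->.
Qed.

(** Pairing the form with its conjugate coefficients counts the addition table. *)
Lemma sym_norm_sum_form : ((#|G|%:R ^+ 2)%:E <= sym_norm Phi)%E.
Proof.
have n0 : (0 < n)%N by apply: leq_ltn_trans (ltn_ord (iota 0)).
apply: (le_trans _ (sym_norm_ge Phi n0 partial_latin_sum_form)).
rewrite lee_fin sum_triple.
have -> : \sum_i \sum_j \sum_k coef Phi (triple i j k) * (coef Phi (triple i j k))^*%C
   = \sum_i \sum_j \sum_k Phi (stdb R i) (stdb R j) (stdb R k) *:
       ((coef Phi (triple i j k))^*%C : C^o).
  by do 3!(apply: eq_bigr => ? _); rewrite {1}/coef !tripleE.
rewrite sum_form_apply; under eq_bigr => x _ do under eq_bigr => y _ do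
  rewrite coef_sum_form_graph [_ *: _]mulrC -normc_sqr phi1 expr1n.
rewrite !sumr_const -mulrnA -(rmorph_nat (real_complex R)) normc_real.
by rewrite ger0_norm// natrM.
Qed.

End SumFormSym.

(** * Cubic phases over finite fields of characteristic three *)

Section Character.
Context {R : realType}.
Local Notation normc := (@ComplexField.Normc.normc R).
Local Notation C := R[i].

Lemma cube_root_unity : exists2 w : C, w ^+ 3 = 1 & w != 1.
Proof.
have [w w_root] := @solve_monicpoly C 2 (nth 0 [:: -1; -1]) isT.
have wE : w ^+ 2 = - 1 - w.
  by rewrite w_root !big_ord_recl big_ord0 /=; ring.
exists w; first by rewrite exprS wE mulrBr -expr2 wE; ring.
apply/eqP => w1; move: wE; rewrite w1 expr1n => /eqP.
rewrite -subr_eq0 [X in X == 0](_ : _ = 3%:R); last by ring.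
by rewrite pnatr_eq0.
Qed.

Definition additive_character (F : zmodType) (chi : F -> C) : Prop :=
  [/\ {morph chi : x y / x + y >-> x * y}, forall x, normc (chi x) = 1
    & exists x, chi x != 1].

(** A translation multiplies the sum by a value of [chi] different from one. *)
Lemma sum_character (F : finFieldType) (chi : F -> C) t :
  additive_character chi -> t != 0 -> \sum_y chi (t * y) = 0.
Proof.
move=> [chiD _ [x chix]] t0.
have := erefl (\sum_y chi (t * y)); rewrite {1}(reindex_inj (addrI (t^-1 * x))).
under eq_bigr => y _ do rewrite mulrDr mulVKf// chiD.
rewrite -mulr_sumr => /eqP; rewrite -subr_eq0 -{2}[\sum_y _]mul1r -mulrBl.
by rewrite mulf_eq0 subr_eq0 (negPf chix) => /eqP.
Qed.

(** The derivative in direction [h] is [chi ((u - y) (2 y h + h^2))]; between two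
    columns the terms free of [u] cancel, leaving a constant times
    [chi (2 h (u' - u) y)]. *)
Lemma cubic_uniform_phase (F : finFieldType) (chi : F -> C) :
  (2 : F) != 0 -> additive_character chi ->
  uniform_phase (fun x y => chi (x * y ^+ 2)).
Proof.
move=> F2 chiP; have [chiD chi1 _] := chiP; split=> // h u u' h0 uu'.
have chi0 : chi 0 = 1.
  have := chiD 0 0; rewrite addr0 => /esym/eqP.
  rewrite -subr_eq0 -{3}[chi 0]mul1r -mulrBl mulf_eq0 subr_eq0.
  case/orP=> /eqP// c0; have := chi1 0; rewrite c0 ComplexField.Normc.normc0.
  by move/eqP; rewrite eq_sym oner_eq0.
have chiJ x : (chi x)^*%C = chi (- x).
  have nz : chi x != 0.
    apply/eqP => c0; have := chi1 x; rewrite c0 ComplexField.Normc.normc0.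
    by move/eqP; rewrite eq_sym oner_eq0.
  by apply: (mulIf nz); rewrite -normc_sqr chi1 expr1n -chiD addNr chi0.
under eq_bigr => y _.
  rewrite /diff_kernel rmorphM /= conjcK !chiJ -!chiD.
  rewrite (_ : _ + _ = (u' - u) * h ^+ 2 + (2 * h * (u' - u)) * y); last by ring.
  rewrite chiD; over.
rewrite -mulr_sumr sum_character ?mulr0// !mulf_neq0// subr_eq0 eq_sym//.
Qed.

(** A nonzero coordinate of the field as a vector space over ['F_3], used as an
    exponent of a primitive cube root of unity. *)
Lemma card_3k_character k : (0 < k)%N ->
  exists (F : finFieldType) (chi : F -> C),
    [/\ #|F| = (3 ^ k)%N, (2 : F) != 0 & additive_character chi].
Proof.
move=> k0; have [F charF cardF] := PrimePowerField (isT : prime 3) k0.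
have [w w3 w1] := cube_root_unity.
pose F' := pPrimeCharType charF.
have [j nzj] : exists j, coord (vbasis {:F'}) j (1 : F') != 0.
  apply/existsP; apply: contraTT (oner_neq0 F') => /existsPn z.
  rewrite negbK; apply/eqP; apply: (etrans (coord_vbasis (memvf (1 : F')))).
  apply: big1 => j _.
  by have /negbNE/eqP -> := z j; rewrite scale0r.
pose c (x : F) := coord (vbasis {:F'}) j (x : F').
have cD x y : c (x + y) = c x + c y by exact: (raddfD (coord (vbasis {:F'}) j)).
exists F, (fun x => w ^+ (c x : nat)); split=> //.
  apply/negP => /eqP F2; have := oner_neq0 F.
  have := pcharf0 charF; rewrite -[3%N]/(2 + 1)%N natrD F2 add0r.
  by move=> /eqP F1 /negP[].
split.
- by move=> x y; rewrite -exprD cD /= expr_mod.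
- move=> x; apply/eqP; rewrite -(@eqrXn2 _ 3)// ?normc_ge0// expr1n.
  have <- : normc (w ^+ (c x : nat) ^+ 3) = normc (w ^+ (c x : nat)) ^+ 3.
    by rewrite !exprS !expr0 !ComplexField.Normc.normcM ComplexField.Normc.normc1.
  by rewrite exprAC w3 expr1n ComplexField.Normc.normc1.
- exists 1; move: nzj; rewrite -/(c 1); case: (c 1) => [[|[|[|//]]] lt3] //= _.
  apply: contra w1 => /eqP w2; by rewrite -w3 exprS w2 mulr1.
Qed.

End Character.

(** * The separation *)

(** The trivial group covers [k = 0], where there is no field: its condition on
    derivatives is vacuous. *)
Lemma uniform_phase_3k (R : realType) k :
  exists (G : finZmodType) (phi : G -> G -> R[i]),
    #|G| = (3 ^ k)%N /\ uniform_phase phi.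
Proof.
case: k => [|k].
  exists 'I_1, (fun _ _ => 1); rewrite card_ord; split=> //; split.
    by move=> _ _; exact: ComplexField.Normc.normc1.
  by move=> h u u' _; rewrite (ord1 u) (ord1 u') eqxx.
have [F [chi [cardF F2 chiP]]] := @card_3k_character R k.+1 isT.
by exists F, (fun x y => chi (x * y ^+ 2)); split=> //; apply: cubic_uniform_phase.
Qed.

(** On fourth powers, with [s = sqrt N], the claim is
    [n / 256 * (2 s^7)^2 <= s^16], and [n <= 3 s^2]. *)
Lemma quartic_root_bound (R : realType) (n N : nat) : (n <= 3 * N)%N ->
  4^-1 * n%:R `^ 4^-1 * Num.sqrt (2 * Num.sqrt N%:R ^+ 7) <= N%:R ^+ 2 :> R.
Proof.
move=> nN; set s := Num.sqrt N%:R.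
have s0 : 0 <= s by exact: sqrtr_ge0.
have sN : s ^+ 2 = N%:R by rewrite sqr_sqrtr.
have t0 : 0 <= 2 * s ^+ 7 by rewrite mulr_ge0 ?exprn_ge0.
rewrite -(@ler_pXn2r _ 4)// ?nnegrE ?mulr_ge0 ?powR_ge0 ?sqrtr_ge0 ?exprn_ge0//.
rewrite !exprMn -(powR_mulrn 4 (powR_ge0 _ _)) -powRrM mulVf// powRr1//.
rewrite -[4%N]/(2 * 2)%N exprM [X in _ * X]exprM sqr_sqrtr// -sN.
have n3 : n%:R <= 3 * s ^+ 2 by rewrite sN -natrM ler_nat.
apply: (@le_trans _ _ ((4^-1 ^+ 2) ^+ 2 * (3 * s ^+ 2) * (2 * s ^+ 7) ^+ 2)).
  by rewrite ler_wpM2r ?sqr_ge0// ler_wpM2l// sqr_ge0.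
rewrite (_ : _ * _ = 12 / 256 * s ^+ 16); last by field.
rewrite [leRHS](_ : _ = s ^+ 16); last by rewrite -!exprM -exprD.
rewrite ler_piMl ?exprn_ge0//; lra.
Qed.

Theorem theorem1p2 (R : realType) :
  exists C c : R, [/\ 0 < C, 0 < c &
    forall n : nat, (0 < n)%N ->
      exists Phi : form3 R n,
        [/\ trilinear Phi,
            exists x y z, Phi x y z <> 0 &
            ((C * n%:R `^ c)%:E * jcb_norm Phi <= sym_norm Phi)%E]].
Proof.
exists 4^-1, 4^-1; split=> // n n0.
have [G [phi [cardG phiP]]] := uniform_phase_3k R (trunc_log 3 n).
have [phi1 _] := phiP.
have /andP[leGn ltnG] := trunc_log_bounds (isT : 1 < 3)%N n0.
rewrite -cardG in leGn.
pose iota (x : G) := widen_ord leGn (enum_rank x).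
have iota_inj : injective iota.
  by move=> x y /(congr1 val)/= /val_inj/enum_rank_inj.
exists (sum_form phi iota); split; first exact: sum_form_trilinear.
  exists (stdb R (iota 0)), (stdb R (iota 0)), (stdb R (iota (0 + 0))).
  have := coef_sum_form_graph phi iota_inj 0 0.
  rewrite /coef !tripleE => -> phi0.
  have := phi1 0 0; rewrite phi0 ComplexField.Normc.normc0.
  by move/esym/eqP; rewrite oner_eq0.
apply: (le_trans _ (sym_norm_sum_form phi1 iota_inj)).
apply: (@le_trans _ _ ((4^-1 * n%:R `^ 4^-1)%:E *
    (Num.sqrt (2 * Num.sqrt #|G|%:R ^+ 7))%:E)%E).
  apply: lee_wpmul2l (jcb_norm_sum_form iota phiP).
  by rewrite lee_fin mulr_ge0 ?powR_ge0.
rewrite -EFinM lee_fin; apply: quartic_root_bound.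
by rewrite cardG -expnS ltnW.
Qed.
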